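(* Suppose that (a) $X=\mathbb L_{\geq 0}$; or (b) $X=\mathbb L$; or (c) $X=\kappa^n\times\lambda_1\times\cdots\times\lambda_j$, where $\kappa$ is an uncountable regular cardinal, $\lambda_1,\dots,\lambda_j$ are successor ordinals smaller than $\kappa$, and $n,j\in\mathbb N$. Then $X$ has the Compactly Supported Homeomorphism Property (CSHP).
   Context: The Closed Long Ray $\mathbb L_{\geq0}$ is $\omega_1\times[0,1)$ with the order topology of the lexicographic order. The Long Line $\mathbb L$ is obtained by gluing a copy of $\mathbb L_{\geq0}$ with the reversed order and a copy with the usual order at their least points $(0,0)$. Ordinals carry the order topology and products the product topology. For a Tychonoff space $X$, the support of a homeomorphism $h$ of $X$ is $\operatorname{cl}_X\{x\mid h(x)\neq x\}$; $\operatorname{Homeo}_{cpt}(X)$ is the group of compactly supported homeomorphisms of $X$. Each such $h$ extends to a homeomorphism of the Stone–Čech compactification $\beta X$ that is the identity on $\beta X\setminus X$, so $\operatorname{Homeo}_{cpt}(X)$ is a subgroup of $\operatorname{Homeo}(\beta X)$, and it is equipped with the compact-open topology induced from $\beta X$. For compact $K\subseteq X$, $\operatorname{Homeo}_K(X)$ is the subgroup of homeomorphisms fixing every point outside $K$, with the subspace topology. $X$ has CSHP if $\operatorname{colim}_{K\in\mathscr K(X)}\operatorname{Homeo}_K(X)=\operatorname{Homeo}_{cpt}(X)$, where the left side is the union $\bigcup_K\operatorname{Homeo}_K(X)$ equipped with the colimit space topology $\{U\mid U\cap\operatorname{Homeo}_K(X)\text{ open in }\operatorname{Homeo}_K(X)\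 \forall K\}$, $\mathscr K(X)$ being the compact subsets of $X$ ordered by inclusion; i.e. this colimit space topology coincides with the topology of $\operatorname{Homeo}_{cpt}(X)$ just described. *)

(* Defs.v *)
From HB Require Import structures.
From mathcomp Require Import all_boot all_order all_algebra.
From mathcomp Require Import all_classical all_reals topology function_spaces order_topology.
From mathcomp Require Import Rstruct Rstruct_topology.
From Stdlib Require Import Rdefinitions.

Set Implicit Arguments.
Unset Strict Implicit.
Unset Printing Implicit Defensive.

Import Order.TTheory GRing.Theory Num.Theory.
Local Open Scope classical_set_scope.

Definition well_order {d} (T : orderType d) : Prop :=
  forall A : set T, A !=set0 -> exists x, A x /\ forall y, A y -> (x <= y)%O.

Definition ord_iso_on {X Y : Type} (ltX : X -> X -> Prop) (ltY : Y -> Y -> Prop)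
  (A : set X) (B : set Y) (f : X -> Y) : Prop :=
  [/\ f @` A = B, {in A &, injective f} &
      forall x y, A x -> A y -> (ltX x y <-> ltY (f x) (f y))].

Definition is_omega1 {d} (W : orderType d) : Prop :=
  [/\ well_order W, ~ countable [set: W] &
      forall a : W, countable [set x : W | (x < a)%O]].

(** [K] is (order-isomorphic to) an uncountable regular cardinal (as an initial
    ordinal): well-ordered, uncountable, every proper initial segment has
    strictly smaller cardinality, and every cofinal subset has full cardinality *)
Definition uncountable_regular_cardinal {d} (K : orderType d) : Prop :=
  [/\ well_order K, ~ countable [set: K],
      (forall a : K, ~ ([set: K] #<= [set x : K | (x < a)%O])%card) &
      (forall A : set K, (forall x, exists2 y, A y & (x <= y)%O) ->
          ([set: K] #<= A)%card)].

Definition successor_ordinal {d} (L : orderType d) : Prop :=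
  well_order L /\ exists m : L, forall x : L, (x <= m)%O.

Definition ordinal_lt {d d'} (L : orderType d) (K : orderType d') : Prop :=
  exists (a : K) (f : L -> K),
    ord_iso_on (fun x y => (x < y)%O) (fun x y => (x < y)%O)
      [set: L] [set x : K | (x < a)%O] f.

Definition lex_lt {d} {W : orderType d} (p q : W * R) : Prop :=
  (p.1 < q.1)%O \/ (p.1 = q.1 /\ (p.2 < q.2)%R).

Definition long_ray_set {d} (W : orderType d) : set (W * R) :=
  [set p | (0 <= p.2)%R /\ (p.2 < 1)%R].
Arguments long_ray_set {d} W.

Definition is_long_ray_order {d d'} (W : orderType d) (X : orderType d') : Prop :=
  exists f : X -> W * R,
    ord_iso_on (fun x y => (x < y)%O) lex_lt [set: X] (long_ray_set W) f.

(** the ordered set [X] is order-isomorphic to the long line: a point [o]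
    such that [[o, +oo)] is isomorphic to the long ray and [(-oo, o]] is
    isomorphic to the long ray with the reversed order (gluing at least points) *)
Definition is_long_line_order {d d'} (W : orderType d) (X : orderType d') : Prop :=
  exists (o : X) (f g : X -> W * R),
    ord_iso_on (fun x y => (x < y)%O) lex_lt [set x | (o <= x)%O] (long_ray_set W) f /\
    ord_iso_on (fun x y => (y < x)%O) lex_lt [set x | (x <= o)%O] (long_ray_set W) g.

Definition is_embedding {X Y : topologicalType} (e : X -> Y) : Prop :=
  [/\ continuous e, injective e &
      forall U : set X, open U -> exists V : set Y, open V /\ e @` U = range e `&` V].

Definition is_stone_cech {X Y : topologicalType} (e : X -> Y) : Prop :=
  [/\ compact [set: Y], hausdorff_space Y, is_embedding e, dense (range e) &
      forall (Z : topologicalType), compact [set: Z] -> hausdorff_space Z ->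
        forall f : X -> Z, continuous f ->
          exists g : Y -> Z, continuous g /\ g \o e = f].

Definition is_homeo {X : topologicalType} (h : X -> X) : Prop :=
  continuous h /\ exists g : X -> X, [/\ cancel h g, cancel g h & continuous g].

Definition support {X : topologicalType} (h : X -> X) : set X :=
  closure [set x | h x <> x].

Definition Homeo_cpt (X : topologicalType) : set (X -> X) :=
  [set h | is_homeo h /\ compact (support h)].

Arguments Homeo_cpt X : clear implicits.

Definition Homeo_K {X : topologicalType} (K : set X) : set (X -> X) :=
  [set h | is_homeo h /\ forall x, ~ K x -> h x = x].

Definition ext {X Y : topologicalType} (e : X -> Y) (h : X -> X) : Y -> Y :=
  fun y => match pselect (exists x, e x = y) with
           | left P => e (h (proj1_sig (cid P)))
           | right _ => y
           end.

Definition co_open {Y : topologicalType} (V : set (Y -> Y)) : Prop :=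
  @open {compact-open, Y -> Y} V.

(** open sets of Homeo_cpt(X) (subspace of Homeo(Y) with the compact-open
    topology, through [h |-> ext e h]) *)
Definition cpt_open {X Y : topologicalType} (e : X -> Y) (U : set (X -> X)) : Prop :=
  exists V : set (Y -> Y), co_open V /\ U = Homeo_cpt X `&` (ext e @^-1` V).

Definition colim_open {X Y : topologicalType} (e : X -> Y) (U : set (X -> X)) : Prop :=
  forall K : set X, compact K ->
    exists V : set (Y -> Y), co_open V /\
      U `&` Homeo_K K = Homeo_K K `&` (ext e @^-1` V).

Definition CSHP (X : topologicalType) : Prop :=
  \bigcup_(K in [set K : set X | compact K]) Homeo_K K = Homeo_cpt X /\
  forall (Y : topologicalType) (e : X -> Y), is_stone_cech e ->
    forall U : set (X -> X), U `<=` Homeo_cpt X ->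
      (colim_open e U <-> cpt_open e U).

(* Main.v *)
Require Import Defs.
From HB Require Import structures.
From mathcomp Require Import all_boot all_order all_algebra.
From mathcomp Require Import all_classical all_reals topology function_spaces order_topology.
From mathcomp Require Import Rstruct Rstruct_topology.
From mathcomp Require Import separation_axioms.

(** Write [K_a] for the compact initial pieces of [X] (intervals, or products of
    intervals), [r_a : X -> K_a] for the clamping retractions, and let [U] be
    open in the colimit topology with [h] in [U].  If no neighbourhood of [h]
    in the compact-open topology worked, each basic condition [M] satisfied by
    [h], where "basic at stage [a]" means expressed through [r_a] by one of
    fewer than [kappa] open sets, would have a witness [k_M] outside [U], with
    support in some [K_b].  By regularity these supports are bounded at each
    stage, so a closing-off argument gives a limit [z] of cofinality omega such
    that [k_M] lies in [Homeo_K K_z] for every [M] basic at a stage below [z].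
    But [K_z] is the inverse limit of the earlier [K_a], so conditions basic
    below [z] already generate the topology of [Homeo_K K_z], and one of them
    forces its witness into [U].  Basic conditions are open for the topology
    coming from [beta X] because every [r_a] extends to [beta X]. *)

Set Implicit Arguments.
Unset Strict Implicit.
Unset Printing Implicit Defensive.

Import Order.TTheory.
Local Open Scope classical_set_scope.

(** * Smallness and clamped spaces *)

(** Smallness is boundedness of every map into [I]. When [I] is a regular cardinal, all sets of
    smaller cardinality have it, and this form avoids cardinal arithmetic. *)
Definition small {d} (I : orderType d) {T} (A : set T) :=
  forall f : T -> I, exists b, forall x, A x -> (f x <= b)%O.

(** Closure into a lattice of sets: finite unions serve compactness arguments, finite intersections
    serve filters. *)
Inductive lat {T} (S : set (set T)) : set (set T) :=
| lat_base A : S A -> lat S A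
| lat0 : lat S set0
| latT : lat S setT
| latU A B : lat S A -> lat S B -> lat S (A `|` B)
| latI A B : lat S A -> lat S B -> lat S (A `&` B).

Lemma lat_sub T (S S' : set (set T)) : S `<=` S' -> lat S `<=` lat S'.
Proof.
move=> SS' A; elim=> {A} [A /SS'|||A B _ + _|A B _ + _].
- exact: lat_base.
- exact: lat0.
- exact: latT.
- exact: latU.
- exact: latI.
Qed.

Lemma lat_preimage T U (f : T -> U) (S : set (set U)) (S' : set (set T)) :
  (forall B, S B -> S' (f @^-1` B)) -> forall B, lat S B -> lat S' (f @^-1` B).
Proof.
move=> SS' A; elim=> {A} [A /SS'|||A B _ + _|A B _ + _].
- exact: lat_base.
- by rewrite preimage_set0; exact: lat0.
- by rewrite preimage_setT; exact: latT.
- by rewrite preimage_setU; exact: latU.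
- by rewrite preimage_setI; exact: latI.
Qed.

Section small.
Context {d} {I : orderType d}.

Lemma small_sub T (A B : set T) : A `<=` B -> small I B -> small I A.
Proof. by move=> AB sB f; have [b bP] := sB f; exists b => x /AB/bP. Qed.

Lemma small_image T U (g : T -> U) (A : set T) : small I A -> small I (g @` A).
Proof. by move=> sA f; have [b bP] := sA (f \o g); exists b => _ [x /bP ? <-]. Qed.

(** Bounds for the separate [B x] form a map on [A], which is bounded in turn. The point [i0] is
    only a default outside [A]. *)
Lemma small_bigcup (i0 : I) T U (A : set T) (B : T -> set U) :
  small I A -> (forall x, A x -> small I (B x)) -> small I (\bigcup_(x in A) B x).
Proof.
move=> sA sB f.
have /choice[b bP] x : exists b, A x -> forall y, B x y -> (f y <= b)%O.
  by have [/sB/(_ f)[b bP]|nAx] := pselect (A x); [exists b | exists i0].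
have [c cP] := sA b; exists c => y [x Ax Bxy].
by rewrite (le_trans (bP x Ax y Bxy)) ?cP.
Qed.

Lemma small_setX (i0 : I) T U (A : set T) (B : set U) :
  small I A -> small I B -> small I (A `*` B).
Proof.
move=> sA sB; apply: (@small_sub _ _ (\bigcup_(x in A) (pair x @` B))).
  by move=> [x y] [/= Ax By]; exists x => //; exists y.
by apply: small_bigcup => // x _; exact: small_image.
Qed.

Lemma small_setU T (A B : set T) : small I A -> small I B -> small I (A `|` B).
Proof.
move=> sA sB f; have [[a aP] [b bP]] := (sA f, sB f).
by exists (Order.max a b) => x [/aP|/bP] fx; rewrite le_max fx ?orbT.
Qed.

Lemma small_set1 T (x : T) : small I [set x].
Proof. by move=> f; exists (f x) => _ ->. Qed.

(** The lattice is exhausted by stages [L n], each adding the pairwise unions and intersections of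
    the previous one. Each stage is small, and there are only countably many. *)
Lemma small_lat (i0 : I) T (S : set (set T)) :
  small I [set: nat] -> small I S -> small I (lat S).
Proof.
move=> sN sS.
pose L := fix L n := if n is m.+1 then
  L m `|` ((fun p => p.1 `|` p.2) @` (L m `*` L m) `|`
           (fun p => p.1 `&` p.2) @` (L m `*` L m))
  else S `|` [set set0; setT].
have sL n : small I (L n).
  elim: n => [|n IH] /=.
    by do ?apply: small_setU => //; exact: small_set1.
  by do ?apply: small_setU => //; apply: small_image; exact: small_setX.
have Lmono m n : (m <= n)%N -> L m `<=` L n.
  move=> /subnK <-; elim: (n - m)%N => [|k IH]; first by rewrite add0n.
  by rewrite addSn => A /IH; left.
apply: (@small_sub _ _ (\bigcup_(n in [set: nat]) L n)); last first.
  by apply: small_bigcup => // n _; exact: sL.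
move=> A; elim=> {A}.
- by move=> A SA; exists 0%N => //; left.
- by exists 0%N => //; right; left.
- by exists 0%N => //; right; right.
- move=> A B _ [m _ Am] _ [n _ Bn]; exists (maxn m n).+1 => //.
  by right; left; exists (A, B) => //; split => /=;
    [apply: (Lmono m)|apply: (Lmono n)] => //; rewrite ?leq_maxl ?leq_maxr.
- move=> A B _ [m _ Am] _ [n _ Bn]; exists (maxn m n).+1 => //.
  by right; right; exists (A, B) => //; split => /=;
    [apply: (Lmono m)|apply: (Lmono n)] => //; rewrite ?leq_maxl ?leq_maxr.
Qed.

End small.

(** The features shared by uncountable regular cardinals and the first uncountable ordinal.
    Smallness of [nat] expresses uncountable cofinality: every sequence is bounded. *)
Definition long_index {d} (I : orderType d) :=
  [/\ well_order I, small I [set: nat] & forall a : I, exists b, (a < b)%O].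

Definition increasing_to {d} {I : orderType d} (c : nat -> I) (e : I) :=
  [/\ forall n, (c n < c n.+1)%O, forall n, (c n < e)%O &
      forall z, (z < e)%O -> exists n, (z < c n)%O].

Lemma increasing_to_homo {d} {I : orderType d} (c : nat -> I) e m n :
  increasing_to c e -> (m <= n)%N -> (c m <= c n)%O.
Proof.
move=> [cS _ _] /subnK <-; elim: (n - m)%N => [|k IH]; first by rewrite add0n.
by rewrite addSn (le_trans IH) ?ltW.
Qed.

(** The closing-off step: iterate [g] from [i0], taking the maximum with a strictly larger element
    so that the sequence strictly increases, and let [e] be its least upper bound. *)
Lemma long_index_limit {d} {I : orderType d} (g : I -> I) (i0 : I) :
  long_index I -> exists c e, [/\ increasing_to c e, c 0%N = i0 &
    forall n, (g (c n) <= c n.+1)%O].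
Proof.
move=> [wo sN nomax]; have /choice[s sP] := nomax.
pose c := fix c n := if n is m.+1 then Order.max (g (c m)) (s (c m)) else i0.
have cS n : (c n < c n.+1)%O by rewrite /= lt_max sP orbT.
have [b bP] := sN c.
have [|e [ce emin]] := wo [set b | forall n, (c n <= b)%O].
  by exists b => n; exact: bP.
have cle n : (c n < e)%O by exact: lt_le_trans (cS n) (ce n.+1).
exists c, e; split => //; last by move=> n; rewrite /= le_max lexx.
split => // z; rewrite ltNge => /negP nez; apply/not_existsP => nc.
by apply: nez; apply: emin => n /=; rewrite leNgt; apply/negP/nc.
Qed.

(** The neighbourhoods of [x] relative to [K] that are visible at the stages [c n]. The limit clause
    of [clamped] says that this filter is at least as fine as the neighbourhood filter of [x]. *)
Definition limit_base {d} {I : orderType d} {X : Type} (S : I -> set (set X))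
    (c : nat -> I) (K : set X) (x : X) : set_system X :=
  [set A | exists n B, [/\ lat (S (c n)) B, B x & B `&` K `<=` A]].

Lemma limit_base_filter {d} {I : orderType d} {X : Type} (S : I -> set (set X))
    (c : nat -> I) e (K : set X) (x : X) :
  (forall a b, (a <= b)%O -> S a `<=` S b) -> increasing_to c e ->
  Filter (limit_base S c K x).
Proof.
move=> Smono ce; split.
- by exists 0%N, setT; split => //; exact: latT.
- move=> A B [m [A' [lA A'x A'A]]] [n [B' [lB B'x B'B]]].
  exists (maxn m n), (A' `&` B'); split => //.
    apply: latI; [apply: lat_sub lA|apply: lat_sub lB]; apply: Smono;
      by rewrite (increasing_to_homo ce) ?leq_maxl ?leq_maxr.
  by move=> y [[A'y B'y] Ky]; split; [apply: A'A|apply: B'B].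
- by move=> A B AB [n [D [? ? DA]]]; exists n, D; split => // y /DA/AB.
Qed.

(* The compacta are the fixed-point sets of the retractions [r a].
   [clamp_limit] says that at a limit [e] of cofinality omega the topology of
   the [e]-th one is generated by sets of the families [S a] with [a] before
   [e], i.e. that it is the inverse limit of the earlier ones. *)
Record clamped {d} {I : orderType d} {X : topologicalType}
    (r : I -> X -> X) (S : I -> set (set X)) : Prop := Clamped {
  clamp_cts : forall a, continuous (r a);
  clampl : forall a b x, (a <= b)%O -> r a (r b x) = r a x;
  clampr : forall a b x, (a <= b)%O -> r b (r a x) = r a x;
  clamp_compact : forall a, compact [set x | r a x = x];
  clamp_exhaust : forall C, compact C -> exists a, C `<=` [set x | r a x = x];
  clamp_reflect : forall a b x, (a < b)%O ->
    r a (r b x) = r b x -> r a x = x;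
  clamp_open : forall a A, S a A -> open A;
  clamp_sat : forall a A x, S a A -> A (r a x) <-> A x;
  clamp_mono : forall a b, (a <= b)%O -> S a `<=` S b;
  clamp_small : forall a, small I (S a);
  clamp_limit : forall c e, increasing_to c e ->
    forall x O, r e x = x -> nbhs x O ->
    limit_base S c [set y | r e y = y] x O
}.

(** The cones of members of [P] containing a given member form a filter, because [P] is directed.
    The near-covering form of compactness along it yields one member covering [A]. *)
Lemma compact_directed_cover {X : topologicalType} (A : set X)
    (P : set (set X)) :
  compact A -> P set0 -> (forall B C, P B -> P C -> P (B `|` C)) ->
  (forall x, A x -> exists2 B, P B & nbhs x B) ->
  exists2 B, P B & A `<=` B.
Proof.
move=> /compact_near_coveringP cA P0 PU Ploc.
pose F := filter_from P (fun B => [set C | P C /\ B `<=` C]).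
have FF : Filter F.
  apply: filter_from_filter; first by exists set0.
  move=> B C PB PC; exists (B `|` C); first exact: PU.
  by move=> D [PD]; rewrite subUset => -[? ?].
have [|B PB] := cA _ F (fun B x => B x) FF.
  move=> x /Ploc[B PB xB]; exists (B, [set C | P C /\ B `<=` C]) => /=.
    by split => //; exists B.
  by move=> [y C] /= [By [_]]; exact.
by move=> /(_ B (conj PB (@subset_refl _ _))) AB; exists B.
Qed.

Lemma eq_on_closure {T U : topologicalType} (f g : T -> U) (A : set T) :
  hausdorff_space U -> continuous f -> continuous g ->
  (forall x, A x -> f x = g x) -> forall y, closure A y -> f y = g y.
Proof.
move=> hU fc gc fg y Ay; apply: hU => P Q fP gQ.
have [|x [Ax [Px Qx]]] := Ay ((f @^-1` P) `&` (g @^-1` Q)).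
  by apply: filterI; [exact: fc|exact: gc].
by exists (f x); split => //; rewrite fg.
Qed.

Lemma eq_on_dense {T U : topologicalType} (f g : T -> U) (A : set T) :
  hausdorff_space U -> continuous f -> continuous g -> dense A ->
  (forall x, A x -> f x = g x) -> f = g.
Proof.
move=> hU fc gc dA fg; apply/funext => y; apply: (eq_on_closure hU fc gc fg).
move=> B; rewrite nbhsE => -[O [oO Oy] OB].
by have [x [Ox Ax]] := dA O (ex_intro _ y Oy) oO; exists x; split => //; exact: OB.
Qed.

(** If [h x] were outside [K], then [h] would fix [h x], and injectivity would give [h x = x]. *)
Lemma Homeo_K_stable {X : topologicalType} (K : set X) h x :
  Homeo_K K h -> K x -> K (h x).
Proof.
move=> [[_ [g [hg _ _]]] hK] Kx; apply: contrapT => nK; apply: (nK).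
by rewrite (can_inj hg (hK _ nK)).
Qed.

Lemma Homeo_K_subset {X : topologicalType} (K L : set X) :
  K `<=` L -> Homeo_K K `<=` Homeo_K L.
Proof. by move=> KL h [? hK]; split => // x nL; apply: hK => /KL. Qed.

Lemma Homeo_K_support {X : topologicalType} (h : X -> X) :
  is_homeo h -> Homeo_K (Defs.support h) h.
Proof.
move=> hh; split => // x nS; apply: contrapT => hx; apply: nS.
exact: subset_closure.
Qed.

Lemma Homeo_K_cpt {X : topologicalType} (K : set X) :
  hausdorff_space X -> compact K -> Homeo_K K `<=` Homeo_cpt X.
Proof.
move=> hX cK h [hh hK]; split => //; apply: (subclosed_compact _ cK).
  exact: closed_closure.
rewrite (closure_id K).1; last exact: compact_closed.
by apply: closure_subset => x; apply: contra_notP => /hK.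
Qed.

(** * Extending maps to the Stone-Čech compactification *)

Section stone_cech.
Context {X Y : topologicalType} (e : X -> Y).
Hypotheses (hX : hausdorff_space X) (scY : is_stone_cech e).

Let cY : compact [set: Y]. Proof. by case: scY. Qed.
Let hY : hausdorff_space Y. Proof. by case: scY. Qed.
Let ce : continuous e. Proof. by case: scY => _ _ []. Qed.
Let ie : injective e. Proof. by case: scY => _ _ []. Qed.
Let de : dense (range e). Proof. by case: scY. Qed.

Lemma extE h x : ext e h (e x) = e (h x).
Proof.
rewrite /ext; case: pselect => [P|[]]; last by exists x.
by case: (cid P) => x' /= /ie ->.
Qed.

Lemma ext_out h y : ~ range e y -> ext e h y = y.
Proof.
move=> ny; rewrite /ext; case: pselect => // -[x xy].
by case: ny; exists x.
Qed.

(** The universal property extends [e \o h] to a continuous [g]. The image of the compact support is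
    closed, so a point outside [range e] is in the closure of the image of its complement, where [g]
    is the identity. *)
Lemma ext_continuous h : Homeo_cpt X h -> continuous (ext e h).
Proof.
move=> [hh cS]; have [hS] := Homeo_K_support hh => hid.
have [_ _ _ _ /(_ Y cY hY (e \o h))[]] := scY.
  by move=> x; apply: continuous_comp; [exact: hh.1|exact: ce].
move=> g [gc ge]; suff <- : g = ext e h by [].
apply/funext => y; have [[x _ <-]|ny] := pselect (range e y).
  by rewrite extE; exact: (congr1 (@^~ x) ge).
rewrite ext_out //.
apply: (@eq_on_closure _ _ g id (e @` ~` Defs.support h)) => //.
- by move=> z; exact: cvg_id.
- move=> _ [x /hid hx <-]; rewrite -[RHS]/(e x) -{2}hx.
  exact: (congr1 (@^~ x) ge).
- have cl : closed (e @` Defs.support h).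
    apply: compact_closed => //; apply: continuous_compact => //.
    exact: continuous_subspaceT.
  move=> B; rewrite nbhsE => -[O [oO Oy] OB].
  have [||z [[Oz nSz] [x _ xz]]] := de (O := O `\` (e @` Defs.support h)).
  + by exists y; split => // -[x _ xy]; apply: ny; exists x.
  + by rewrite setDE; apply: openI => //; exact: closed_openC.
  + exists z; split; last exact: OB.
    by exists x => // Sx; apply: nSz; exists x.
Qed.

Lemma sc_lift (f : X -> X) (K : set X) : continuous f -> compact K ->
  (forall x, K (f x)) ->
  exists2 p : Y -> X, continuous p & forall x, p (e x) = f x.
Proof.
move=> fc cK fK.
have [_ _ [_ _ oe] _ /(_ Y cY hY (e \o f))[]] := scY.
  by move=> x; apply: continuous_comp; [exact: fc|exact: ce].
move=> g [gc ge].
have geE x : g (e x) = e (f x) by exact: (congr1 (@^~ x) ge).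
have cl : closed (e @` K).
  apply: compact_closed => //; apply: continuous_compact => //.
  exact: continuous_subspaceT.
have /choice[p pE] y : exists x, e x = g y.
  suff [x _ xE] : (e @` K) (g y) by exists x.
  apply: contrapT => ng.
  have [||z [nK [x _ xz]]] := de (O := g @^-1` (~` (e @` K))).
  - by exists y.
  - by apply: open_comp => [z _|]; [exact: gc|exact: closed_openC].
  - by apply: nK; rewrite -xz geE; exists (f x).
exists p; last by move=> x; apply: ie; rewrite pE geE.
apply/continuousP => A /oe[V [oV AV]].
suff -> : p @^-1` A = g @^-1` V by apply: open_comp => // z _; exact: gc.
apply/seteqP; split => y /=.
  move=> Ap; have : (e @` A) (e (p y)) by exists (p y).
  by rewrite AV -pE => -[].
rewrite -pE => Vp; have : (range e `&` V) (e (p y)) by split => //; exists (p y).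
by rewrite -AV => -[x Ax /ie <-].
Qed.

End stone_cech.

(** * CSHP for clamped spaces *)

Section clamped_theory.
Context {d} {I : orderType d} {X : topologicalType}
  (r : I -> X -> X) (S : I -> set (set X)).
Hypotheses (hX : hausdorff_space X) (lI : long_index I) (clS : clamped r S).

Let K a := [set x | r a x = x].

Let Kmono a b : (a <= b)%O -> K a `<=` K b.
Proof. by move=> ab x Kx; rewrite /K /= -Kx (clampr clS). Qed.

Let rK a x : K a (r a x).
Proof. by rewrite /K /= (clampr clS). Qed.

Let cK a : compact (K a).
Proof. exact: (clamp_compact clS). Qed.

Let rc a : continuous (r a).
Proof. by move=> x; exact: (clamp_cts clS). Qed.

Lemma lat_clamp_sat a A x : lat (S a) A -> A (r a x) <-> A x.
Proof.
elim=> {A} // [A SA|A B _ IA _ IB|A B _ IA _ IB].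
- exact: (clamp_sat clS).
- by split=> -[/IA|/IB]; by [left|right].
- by split=> -[/IA ? /IB ?].
Qed.

Lemma lat_clamp_open a A : lat (S a) A -> open A.
Proof.
elim=> {A} [A /(clamp_open clS)//|||A B _ IA _ IB|A B _ IA _ IB].
- exact: open0.
- exact: openT.
- exact: openU.
- exact: openI.
Qed.

(** On [K a] both sides are [h x], since [h] preserves [K a]. Off [K a], strictness of [a < b] and
    [clamp_reflect] keep [r b x] outside [K a], so [h] fixes both [x] and [r b x]. *)
Lemma clamp_comm a b h x : (a < b)%O -> Homeo_K (K a) h ->
  r b (h x) = h (r b x).
Proof.
move=> ab hK; have [Kx|nKx] := pselect (K a x).
  have Kh := Homeo_K_stable hK Kx.
  have KE z : K a z -> r b z = z by exact: Kmono (ltW ab) z.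
  by rewrite !KE.
rewrite hK.2 // hK.2 //; apply: contra_not nKx.
exact: (clamp_reflect clS).
Qed.

(** The basic conditions of stage [a]. A generator says that [h] maps the complement of [p.1] into
    [p.2], in imitation of a subbasic compact-open set. *)
Definition codes a : set (set (X -> X)) :=
  lat ((fun p : set X * set X => [set h | forall x, p.1 x \/ p.2 (h x)])
         @` (lat (S a) `*` lat (S a))).

Lemma codes_mono a b : (a <= b)%O -> codes a `<=` codes b.
Proof.
move=> ab; apply: lat_sub => _ [p [p1 p2] <-]; exists p => //.
by split; apply: (lat_sub (clamp_mono clS ab)).
Qed.

Lemma codes_small a : small I (codes a).
Proof.
have [_ sN _] := lI; apply: (small_lat a sN).
apply: small_image; apply: small_setX => //;
  by apply: (small_lat a sN); exact: (clamp_small clS).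
Qed.

(* A compactly supported [h] commutes with [r b] for large [b], so a condition
   on [h] expressed through [r a] extends to [ext e h] by density. *)
Lemma codes_co_open {Y : topologicalType} (e : X -> Y) a M :
  is_stone_cech e -> codes a M ->
  exists2 N, co_open N & forall h, Homeo_cpt X h -> N (ext e h) <-> M h.
Proof.
move=> scY; elim=> {M}; last 2 first.
- move=> A B _ [N oN NA] _ [N' oN' NB]; exists (N `|` N').
    exact: openU.
  by move=> h hc; split=> -[/(NA _ hc)|/(NB _ hc)]; by [left|right].
- move=> A B _ [N oN NA] _ [N' oN' NB]; exists (N `&` N').
    exact: openI.
  by move=> h hc; split=> -[/(NA _ hc) ? /(NB _ hc)].
- move=> _ [[G O] /= [lG lO] <-].
  have [cY hY _ de _] := scY.
  have lift b := sc_lift scY (@rc b) (@cK b) (rK b).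
  have [p pc pE] := lift a.
  exists [set f | f @` (~` (p @^-1` G)) `<=` p @^-1` O].
    apply: compact_open_open.
      apply: (subclosed_compact _ cY) => //; apply: open_closedC.
      by apply: open_comp => [z _|]; [exact: pc|exact: lat_clamp_open lG].
    by apply: open_comp => [z _|]; [exact: pc|exact: lat_clamp_open lO].
  move=> h hc; split => /= [Nh x|Mh _ [y nG <-]].
    have [Gx|nG] := pselect (G x); [by left|right].
    apply/(lat_clamp_sat _ lO); rewrite -pE -(extE scY).
    apply: Nh; exists (e x) => //= Gx; apply: nG.
    by apply/(lat_clamp_sat _ lG); rewrite -pE.
  have [c cP] := clamp_exhaust clS hc.2.
  (* Stage [b] is strictly above a stage containing the support, as [clamp_comm] requires, and above
     [a], so that [p] factors through the lift [q] of [r b]. *)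
  have [b cb] : exists b, (Order.max a c < b)%O by have [_ _] := lI; apply.
  have [q qc qE] := lift b.
  have hK : Homeo_K (K (Order.max a c)) h.
    apply: Homeo_K_subset (Homeo_K_support hc.1) => x /cP.
    by apply: Kmono; rewrite le_max lexx orbT.
  have pq z : p z = r a (q z).
    rewrite -[RHS]/((r a \o q) z); congr (_ z).
    apply: (eq_on_dense hX pc _ de) => [x|_ [x _ <-] /=].
      by apply: continuous_comp; [exact: qc|exact: rc].
    by rewrite pE qE (clampl clS) // ltW // (le_lt_trans _ cb) // le_max lexx.
  have qh z : q (ext e h z) = h (q z).
    rewrite -[LHS]/((q \o ext e h) z) -[RHS]/((h \o q) z); congr (_ z).
    apply: (eq_on_dense hX _ _ de) => [x|x|_ [x _ <-] /=].
    - by apply: continuous_comp; [exact: (ext_continuous scY hc)|exact: qc].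
    - by apply: continuous_comp; [exact: qc|exact: hc.1.1].
    - by rewrite (extE scY) !qE (clamp_comm _ cb).
  rewrite /= pq lat_clamp_sat // qh.
  by have [/(lat_clamp_sat _ lG)|//] := Mh (q y); rewrite -pq => /nG.
- by exists set0; [exact: open0|].
- by exists setT; [exact: openT|].
Qed.
(** This extends [clamp_limit] from points to compact sets. The admissible [B] form a directed
    family, because two stages [c m] and [c n] lie below a common one. *)
Lemma limit_cover c z A O : increasing_to c z -> compact A -> A `<=` K z ->
  open O -> A `<=` O ->
  exists n B, [/\ lat (S (c n)) B, A `<=` B & B `&` K z `<=` O].
Proof.
move=> cz cA AK oO AO.
have [||x Ax|B [n [lB BO]] AB] := @compact_directed_cover _ _
  [set B | exists n, lat (S (c n)) B /\ B `&` K z `<=` O] cA; last first.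
- by exists n, B.
- have [n [B [lB Bx BO]]] := clamp_limit clS cz (AK _ Ax)
    (open_nbhs_nbhs (conj oO (AO _ Ax))).
  exists B; first by exists n.
  by apply: open_nbhs_nbhs; split => //; exact: lat_clamp_open lB.
- move=> B C [m [lB BO]] [n [lC CO]]; exists (maxn m n).
  split; last by rewrite setIUl subUset.
  apply: latU; [move: lB | move: lC]; apply: lat_sub; apply: (clamp_mono clS);
    by apply: (increasing_to_homo cz); rewrite ?leq_maxl ?leq_maxr.
- by exists 0%N; split; [exact: lat0|rewrite set0I].
Qed.

(** Two approximations give the code. [B1] surrounds the image under [h] of the part of [C] in [K z]
    and stays in [O] on [K z]; [B2] contains the points of [K z] that [h] sends outside [B1] and
    avoids that part of [C]. *)
Lemma limit_code {Y : topologicalType} (e : X -> Y) c z a h (C O : set Y) :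
  is_stone_cech e -> increasing_to c z -> (a < z)%O -> Homeo_K (K a) h ->
  closed C -> open O -> (forall y, C y -> O (ext e h y)) ->
  exists n M, [/\ codes (c n) M, M h &
    forall k, Homeo_K (K z) k -> M k -> forall y, C y -> O (ext e k y)].
Proof.
move=> scY cz az hK cC oO hCO.
have [_ _ [ce _ _] _ _] := scY.
have hKz : Homeo_K (K z) h by apply: Homeo_K_subset hK; apply/Kmono/ltW.
have hc : continuous h := hK.1.1.
have oeO : open (e @^-1` O) by apply: open_comp => // x _; exact: ce.
have ceC : closed (e @^-1` C) by apply: preimage_closed => // x _; exact: ce.
have clK : closed (K z) by exact: compact_closed.
have cA : compact (e @^-1` C `&` K z).
  by rewrite setIC; exact: compact_closedI.
have [n1 [B1 [lB1 AB1 B1O]]] : exists n B, [/\ lat (S (c n)) B,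
    h @` (e @^-1` C `&` K z) `<=` B & B `&` K z `<=` e @^-1` O].
  apply: limit_cover => //.
  - by apply: continuous_compact => //; exact: continuous_subspaceT.
  - by move=> _ [x [_ Kx] <-]; exact: Homeo_K_stable hKz Kx.
  - by move=> _ [x [/= Cx _] <-]; rewrite /preimage /= -(extE scY); exact: hCO.
have [n2 [B2 [lB2 AB2 B2O]]] : exists n B, [/\ lat (S (c n)) B,
    K z `&` ~` (h @^-1` B1) `<=` B & B `&` K z `<=` ~` (e @^-1` C `&` K z)].
  apply: limit_cover => //.
  - apply: compact_closedI => //; apply: open_closedC.
    by apply: open_comp => [x _|]; [exact: hc|exact: lat_clamp_open lB1].
  - by apply: closed_openC; apply: compact_closed.
  - by move=> x [Kx nB] [Cx _]; apply: nB; apply: AB1; exists x.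
pose n := maxn n1 n2.
have mono m B : (m <= n)%N -> lat (S (c m)) B -> lat (S (c n)) B.
  move=> mn; apply: lat_sub; apply: (clamp_mono clS).
  exact: (increasing_to_homo cz).
have {}lB1 := mono _ _ (leq_maxl _ _) lB1.
have {}lB2 := mono _ _ (leq_maxr _ _) lB2.
have cnz : (c n <= z)%O by have [_ /(_ n)/ltW] := cz.
exists n, [set k | forall x, B2 x \/ B1 (k x)]; split.
- by apply: lat_base; exists (B2, B1).
(* The code quantifies over all of [X], while [B2] is controlled only on [K z]. Saturation replaces
   [x] by [r z x] and [h x] by [r z (h x)], which is [h (r z x)] because [a < z]. *)
- move=> x; rewrite -(lat_clamp_sat x lB2) -(clampl clS x cnz) (lat_clamp_sat _ lB2).
  rewrite -(lat_clamp_sat (h x) lB1) -(clampl clS (h x) cnz).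
  rewrite (lat_clamp_sat _ lB1) (clamp_comm _ az hK).
  have [Bh|nBh] := pselect (B1 (h (r z x))); [by right|left].
  by apply: AB2; split => //; exact: rK.
- move=> k kK Mk y Cy.
  (* Outside [range e], and at images of points outside [K z], the extensions of [k] and [h] agree,
     so the condition on [h] transfers; only points of [K z] need the code. *)
  have [[x _ xy]|ny] := pselect (range e y); last first.
    by rewrite (ext_out k ny) -(ext_out h ny); exact: hCO.
  rewrite -xy (extE scY).
  have [Kx|nKx] := pselect (K z x); last first.
    by rewrite kK.2 // -(hKz.2 _ nKx) -(extE scY) xy; exact: hCO.
  have Cx : (e @^-1` C) x by rewrite /preimage /= xy.
  have [B2x|B1x] := Mk x; first by case: (B2O x).
  by apply: (B1O (k x)); split => //; exact: Homeo_K_stable kK Kx.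
Qed.

(** The codes satisfied by [h] generate a filter, so its convergence to [ext e h] need only be
    tested on subbasic compact-open sets, which is [limit_code]. *)
Lemma limit_nbhs {Y : topologicalType} (e : X -> Y) c z a h (V : set (Y -> Y)) :
  is_stone_cech e -> increasing_to c z -> (a < z)%O -> Homeo_K (K a) h ->
  co_open V -> V (ext e h) ->
  exists n M, [/\ codes (c n) M, M h &
    forall k, Homeo_K (K z) k -> M k -> V (ext e k)].
Proof.
move=> scY cz az hK oV Vh.
have [_ hY _ _ _] := scY.
pose F : set_system (Y -> Y) := [set A | exists n M, [/\ codes (c n) M, M h &
    forall k, Homeo_K (K z) k -> M k -> A (ext e k)]].
have FF : Filter F.
  split.
  - by exists 0%N, setT; split => //; exact: latT.
  - move=> A B [m [M [cM Mh MA]]] [n [N [cN Nh NB]]].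
    exists (maxn m n), (M `&` N); split => //; last first.
      by move=> k kK [Mk Nk]; split; [exact: MA|exact: NB].
    apply: latI; [move: cM | move: cN]; apply: codes_mono;
      by apply: (increasing_to_homo cz); rewrite ?leq_maxl ?leq_maxr.
  - by move=> A B AB [n [M [cM Mh MA]]]; exists n, M; split => // k kK Mk; exact/AB/MA.
suff : F --> (ext e h : {compact-open, Y -> Y}).
  by apply; apply: open_nbhs_nbhs.
apply/compact_open_cvgP => C O cC oO hCO.
have [|n [M [cM Mh MP]]] := limit_code scY cz az hK (compact_closed hY cC) oO.
  by move=> y Cy; apply: hCO; exists y.
exists n, M; split => // k kK Mk _ [y Cy <-]; exact: MP kK Mk y Cy.
Qed.

Lemma CSHP_of_clamped : CSHP X.
Proof.
split.
  apply/seteqP; split => [h [C cC hC]|h hc]; first exact: (Homeo_K_cpt hX cC hC).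
  by exists (Defs.support h); [exact: hc.2|exact: Homeo_K_support hc.1].
move=> Y e scY U UG; split; last first.
  move=> [V [oV UV]] C cC; exists V; split => //.
  rewrite UV; apply/seteqP; split => h; first by case=> -[].
  by move=> [hC Vh]; have hc := Homeo_K_cpt hX cC hC; do 2!split => //.
move=> cU.
suff loc h : U h -> exists V : set (Y -> Y), [/\ co_open V, V (ext e h) &
    Homeo_cpt X `&` (ext e @^-1` V) `<=` U].
  exists (\bigcup_(V in [set V | co_open V /\
    Homeo_cpt X `&` (ext e @^-1` V) `<=` U]) V); split.
    by apply: bigcup_open => V [].
  apply/seteqP; split => h; last by case=> hc [V [_ VU] Vh]; exact: VU.
  by move=> Uh; split; [exact: UG|have [V [? ? ?]] := loc h Uh; exists V].
move=> Uh; apply: contrapT => noV.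
have [a0 a0P] := clamp_exhaust clS (UG _ Uh).2.
have hK : Homeo_K (K a0) h.
  exact: (Homeo_K_subset a0P (Homeo_K_support (UG _ Uh).1)).
(* For each code [M] containing [h], [g] selects a stage carrying a witness in [M] outside [U]:
   without one, the open set coded by [M] would be a neighbourhood contradicting [noV]. The value
   [a0] is a default for all other pairs. *)
have /choice[g gP] (aM : I * set (X -> X)) : exists b,
    codes aM.1 aM.2 -> aM.2 h ->
    exists k, [/\ Homeo_K (K b) k, aM.2 k & ~ U k].
  case: aM => a M /=; have [[cM Mh]|nM] := pselect (codes a M /\ M h); last first.
    by exists a0 => ? ?; case: nM.
  have [N oN NM] := codes_co_open scY cM.
  have [k [kc Nk nUk]] : exists k, [/\ Homeo_cpt X k, N (ext e k) & ~ U k].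
    apply: contrapT => nk; apply: noV; exists N; split => //.
      by apply/(NM _ (UG _ Uh)).
    by move=> k [kc Nk]; apply: contrapT => nUk; apply: nk; exists k.
  have [b bP] := clamp_exhaust clS kc.2.
  exists b => _ _; exists k; split => //; last exact/(NM _ kc).
  exact: (Homeo_K_subset bP (Homeo_K_support kc.1)).
have /choice[f fP] a : exists b, forall M, codes a M -> (g (a, M) <= b)%O.
  exact: (codes_small a (fun M => g (a, M))).
have [c [z [cz c0 cf]]] := long_index_limit f a0 lI.
have a0z : (a0 < z)%O by case: cz => _ /(_ 0%N); rewrite c0.
have [V [oV UV]] := cU (K z) (@cK z).
have Vh : V (ext e h).
  suff : (Homeo_K (K z) `&` ext e @^-1` V) h by case.
  by rewrite -UV; split => //; exact: (Homeo_K_subset (Kmono (ltW a0z)) hK).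
(* The code [M] belongs to a stage [c n] before [z], so its witness [k] is supported at a stage at
   most [f (c n)], hence at most [c n.+1], which is below [z]. Then [M] forces [k] into [U]. *)
have [n [M [cM Mh MV]]] := limit_nbhs scY cz a0z hK oV Vh.
have [k [kK Mk nUk]] := gP (c n, M) cM Mh.
have {}kK : Homeo_K (K z) k.
  apply: Homeo_K_subset kK; apply: Kmono.
  apply: (le_trans (fP (c n) M cM)); apply: (le_trans (cf n)).
  by have [_ /(_ n.+1)/ltW] := cz.
suff : (U `&` Homeo_K (K z)) k by case.
by rewrite UV; split => //; exact: MV.
Qed.

End clamped_theory.

(** * Products *)

Lemma hausdorff_pair {X Y : topologicalType} :
  hausdorff_space X -> hausdorff_space Y -> hausdorff_space (X * Y)%type.
Proof.
move=> hX hY [x y] [x' y'] cl; congr pair.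
  apply: hX => A B xA x'B; have [||[u v] [Au Bu]] := cl (fst @^-1` A) (fst @^-1` B).
  - by exists (A, setT) => //=; [split => //; exact: filterT|move=> ? []].
  - by exists (B, setT) => //=; [split => //; exact: filterT|move=> ? []].
  - by exists u.
apply: hY => A B xA x'B; have [||[u v] [Au Bu]] := cl (snd @^-1` A) (snd @^-1` B).
- by exists (setT, A) => //=; [split => //; exact: filterT|move=> ? []].
- by exists (setT, B) => //=; [split => //; exact: filterT|move=> ? []].
- by exists v.
Qed.

Lemma clamped_pair {d} {I : orderType d} {X Y : topologicalType}
    (r : I -> X -> X) S (r' : I -> Y -> Y) S' :
  clamped r S -> clamped r' S' ->
  clamped (fun a (p : X * Y) => (r a p.1, r' a p.2))
    (fun a => (preimage fst @` S a) `|` (preimage snd @` S' a)).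
Proof.
move=> cS cS'; split.
- move=> a p; apply: cvg_pair.
    by apply: cvg_comp; [exact: cvg_fst|exact: (clamp_cts cS)].
  by apply: cvg_comp; [exact: cvg_snd|exact: (clamp_cts cS')].
- by move=> a b p ab; rewrite /= (clampl cS)// (clampl cS').
- by move=> a b p ab; rewrite /= (clampr cS)// (clampr cS').
- move=> a; rewrite [X in compact X](_ : _ =
    [set x | r a x = x] `*` [set y | r' a y = y]).
    by apply: compact_setX; [exact: (clamp_compact cS)|exact: (clamp_compact cS')].
  by apply/seteqP; split=> -[x y] /=; case=> -> ->.
- move=> C cC.
  have [a aP] : exists a, fst @` C `<=` [set x | r a x = x].
    apply: (clamp_exhaust cS); apply: continuous_compact => //.
    by apply: continuous_subspaceT => x; exact: cvg_fst.
  have [b bP] : exists b, snd @` C `<=` [set x | r' b x = x].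
    apply: (clamp_exhaust cS'); apply: continuous_compact => //.
    by apply: continuous_subspaceT => x; exact: cvg_snd.
  exists (Order.max a b) => -[x y] Cxy /=.
  have xE : r a x = x by apply: aP; exists (x, y).
  have yE : r' b y = y by apply: bP; exists (x, y).
  by rewrite -xE -yE (clampr cS) ?(clampr cS') // le_max lexx ?orbT.
- move=> a b [x y] ab /= [/(clamp_reflect cS ab) -> ].
  by move=> /(clamp_reflect cS' ab) ->.
- move=> a _ [[A SA <-]|[A SA <-]]; apply: open_comp.
  + by move=> x _; exact: cvg_fst.
  + exact: (clamp_open cS SA).
  + by move=> x _; exact: cvg_snd.
  + exact: (clamp_open cS' SA).
- move=> a _ p [[A SA <-]|[A SA <-]]; first exact: (clamp_sat cS).
  exact: (clamp_sat cS').
- move=> a b ab _ [[A SA <-]|[A SA <-]]; [left|right]; exists A => //.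
    exact: (clamp_mono cS ab).
  exact: (clamp_mono cS' ab).
- move=> a; apply: small_setU; apply: small_image.
    exact: (clamp_small cS).
  exact: (clamp_small cS').
- move=> c e ce [x y] O [xE yE] [[A B] /= [xA yB] ABO].
  have [m [A' [lA A'x A'A]]] := clamp_limit cS ce xE xA.
  have [n [B' [lB B'y B'B]]] := clamp_limit cS' ce yE yB.
  exists (maxn m n), ((fst @^-1` A') `&` (snd @^-1` B')); split => //.
    apply: latI.
      apply: (lat_preimage _ lA) => D SD; left; exists D => //.
      by apply: (clamp_mono cS _ SD); rewrite (increasing_to_homo ce) ?leq_maxl.
    apply: (lat_preimage _ lB) => D SD; right; exists D => //.
    by apply: (clamp_mono cS' _ SD); rewrite (increasing_to_homo ce) ?leq_maxr.
  by move=> [u v] /= [[A'u B'v] [uE vE]]; apply: ABO; split; [exact: A'A|exact: B'B].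
Qed.

Lemma cvg_prod_topology {J : choiceType} {X : J -> topologicalType}
    (F : set_system (prod_topology X)) (f : prod_topology X) :
  Filter F -> (forall j, proj j @ F --> f j) -> F --> f.
Proof.
move=> FF Fj; apply/cvg_sup => j A /=.
move=> [_ [[B oB <-] /= Bf BA]].
by apply: (filterS BA); apply: (Fj j); exact: open_nbhs_nbhs.
Qed.

Lemma clamped_prod {d} {I : orderType d} (i0 : I) {J : finType}
    {X : J -> topologicalType}
    (r : forall j, I -> X j -> X j) (S : forall j, I -> set (set (X j))) :
  small I [set: nat] -> (forall j, clamped (r j) (S j)) ->
  clamped (fun a (f : prod_topology X) => (fun j => r j a (f j)) : prod_topology X)
    (fun a => \bigcup_(j in [set: J]) (preimage (proj j) @` S j a)).
Proof.
move=> sN cS.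
have sJ : small I [set: J].
  (* A finite index type is encoded in [nat], with [i0] at numbers that encode nothing. Its
     smallness later gives one stage serving all coordinates. *)
  move=> g; have [b bP] := sN (fun n => oapp g i0 (unpickle n)).
  by exists b => j _; have := bP (pickle j) Logic.I; rewrite pickleK.
split.
- move=> a f; pose G (g : prod_topology X) : prod_topology X := fun j => r j a (g j).
  have FG : Filter (G @ nbhs f) by exact: fmap_filter (nbhs_filter f).
  apply: (cvg_prod_topology FG) => j.
  exact: (cvg_comp _ _ (@proj_continuous _ _ j f) (@clamp_cts _ _ _ _ _ (cS j) a (f j))).
- by move=> a b f ab; apply: functional_extensionality_dep => j; rewrite (clampl (cS j)).
- by move=> a b f ab; apply: functional_extensionality_dep => j; rewrite (clampr (cS j)).
- move=> a; rewrite [X in compact X](_ : _ =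
    [set f | forall j, [set x | r j a x = x] (f j)]).
    exact: (tychonoff (fun j => @clamp_compact _ _ _ _ _ (cS j) a)).
  apply/seteqP; split => f /= fE; first by move=> j; exact: (congr1 (fun g => g j) fE).
  exact: functional_extensionality_dep.
- move=> C cC.
  have /choice[a aP] j : exists a, proj j @` C `<=` [set x | r j a x = x].
    apply: (clamp_exhaust (cS j)); apply: continuous_compact => //.
    by apply: continuous_subspaceT; exact: proj_continuous.
  have [b bP] := sJ a; exists b => f Cf; apply: functional_extensionality_dep => j.
  have fE : r j (a j) (f j) = f j by apply: (aP j); exists f.
  by rewrite -fE (clampr (cS j)) // bP.
- move=> a b f ab fE; apply: functional_extensionality_dep => j.
  by apply: (clamp_reflect (cS j) ab); exact: (congr1 (fun g => g j) fE).
- move=> a _ [j _ [A SA <-]]; apply: open_comp => [x _|].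
    exact: proj_continuous.
  exact: (clamp_open (cS j) SA).
- by move=> a _ f [j _ [A SA <-]]; exact: (clamp_sat (cS j)).
- move=> a b ab _ [j _ [A SA <-]]; exists j => //; exists A => //.
  exact: (clamp_mono (cS j) ab).
- move=> a; apply: small_bigcup => // j _; apply: small_image.
  exact: (clamp_small (cS j)).
- move=> c e ce f O fE fO.
  set T := fun a => _; set K := [set g | _].
  have FF : Filter (limit_base T c K f).
    apply: (limit_base_filter K f _ ce) => a b ab _ [j _ [A SA <-]].
    by exists j => //; exists A => //; exact: (clamp_mono (cS j) ab).
  suff : limit_base T c K f --> f by exact.
  apply: cvg_prod_topology => j A fA.
  have fjE : r j e (f j) = f j by exact: (congr1 (fun g => g j) fE).
  have [n [B [lB Bf BA]]] := clamp_limit (cS j) ce fjE fA.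
  exists n, (proj j @^-1` B); split => //.
    by apply: (lat_preimage _ lB) => D SD; exists j => //; exists D.
  by move=> g [Bg gE]; apply: BA; split => //; exact: (congr1 (fun g => g j) gE).
Qed.

(** * Linearly ordered spaces *)

Section order_topology.
Context {dX} {X : orderTopologicalType dX}.

Lemma open_gt (q : X) : open [set y | (q < y)%O].
Proof. by have := @rray_open _ X q; rewrite set_itvE. Qed.

Lemma open_lt (q : X) : open [set y | (y < q)%O].
Proof. by have := @lray_open _ X q; rewrite set_itvE. Qed.

Lemma order_cvg (F : set_system X) (x : X) : Filter F ->
  (forall u, (u < x)%O -> F [set y | (u < y)%O]) ->
  (forall v, (x < v)%O -> F [set y | (y < v)%O]) -> F --> x.
Proof.
move=> FF Fl Fr A /=; rewrite itv_nbhsE => -[i [+ +] iA].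
have {iA} sub B : F B -> B `<=` [set` i] -> F A.
  by move=> FB Bi; apply: filterS FB => y /Bi/iA.
case: i sub => [][[]u|[]] [[]v|[]] // sub _ /[!in_itv] /=.
- move=> /andP[/Fl ux /Fr xv]; apply: (sub _ (filterI ux xv)) => y [/= uy yv].
  by rewrite in_itv /= uy.
- by rewrite andbT => /Fl /sub; apply => y /=; rewrite in_itv /= andbT.
- by move=> /Fr /sub; apply => y /=; rewrite in_itv.
- by move=> _; exact: (sub _ filterT).
Qed.

(** An ultrafilter on the interval converges to the infimum of those [x] whose lower set
    [[set y | (y <= x)%O]] belongs to it. *)
Lemma order_interval_compact (a b : X) :
  (forall A : set X, A !=set0 -> (forall x, A x -> (a <= x <= b)%O) ->
    exists c, (forall x, A x -> (c <= x)%O) /\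
      forall z, (forall x, A x -> (z <= x)%O) -> (z <= c)%O) ->
  compact [set x | (a <= x <= b)%O].
Proof.
move=> infA; rewrite compact_ultra => F FU Fab.
have [||c [clb cglb]] := infA
  [set x | (a <= x <= b)%O /\ F [set y | (y <= x)%O]].
- have [x xab] : [set x | (a <= x <= b)%O] !=set0 by exact: filter_ex Fab.
  exists b; split; first by case/andP: xab => ax xb; rewrite (le_trans ax xb) lexx.
  by apply: filterS Fab => y /andP[].
- by move=> x [].
have ac : (a <= c)%O by apply: cglb => x [/andP[]].
have cb : (c <= b)%O.
  have [x xab] : [set x | (a <= x <= b)%O] !=set0 by exact: filter_ex Fab.
  apply: clb; split; first by case/andP: xab => ax xb; rewrite (le_trans ax xb) lexx.
  by apply: filterS Fab => y /andP[].
exists c; split; first by apply/andP.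
apply: order_cvg => [u uc|v cv].
  have [ua|au] := ltP u a.
    by apply: filterS Fab => y /andP[ay _]; exact: lt_le_trans ay.
  have [//|Fu] := in_ultra_setVsetC [set y | (u < y)%O] FU.
  suff : (c <= u)%O by rewrite leNgt uc.
  apply: clb; split; first by rewrite au (le_trans (ltW uc)).
  by apply: filterS Fu => y /=; rewrite leNgt => /negP.
apply: contrapT => nF.
suff : (v <= c)%O by rewrite leNgt cv.
apply: cglb => x [_ Fx]; rewrite leNgt; apply/negP => xv; apply: nF.
by apply: filterS Fx => y /= yx; exact: le_lt_trans yx xv.
Qed.

End order_topology.

(** The compacta are the intervals from [lo a] to [hi a], and the basic sets are saturated open rays
    with endpoints in [Q a]. The strictness hypotheses make an interval grow on each side where
    points remain; the last one supplies endpoints from stages before a limit. *)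
Lemma clamped_order {d} {I : orderType d} (i0 : I) {dX} {X : orderTopologicalType dX}
    (lo hi : I -> X) (Q : I -> set X) :
  (forall a : I, exists b, (a < b)%O) ->
  (forall a, (lo a <= hi a)%O) ->
  (forall a b : I, (a <= b)%O -> (lo b <= lo a)%O && (hi a <= hi b)%O) ->
  (forall (a b : I) x, (a < b)%O -> (x < lo a)%O -> (lo b < lo a)%O) ->
  (forall (a b : I) x, (a < b)%O -> (hi a < x)%O -> (hi a < hi b)%O) ->
  (forall a, compact [set x | (lo a <= x <= hi a)%O]) ->
  (forall x, exists a, (lo a <= x <= hi a)%O) ->
  (forall a b : I, (a <= b)%O -> Q a `<=` Q b) ->
  (forall a, small I (Q a)) ->
  (forall c e, increasing_to c e -> forall x y, (x < y)%O ->
    (lo e <= x)%O -> (y <= hi e)%O ->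
    (exists n q, [/\ Q (c n) q, (lo (c n) <= q < hi (c n))%O & (x <= q < y)%O]) /\
    (exists n q, [/\ Q (c n) q, (lo (c n) < q <= hi (c n))%O & (x < q <= y)%O])) ->
  clamped (fun a x => Order.max (lo a) (Order.min x (hi a)))
    (fun a => [set A | (exists2 q, Q a q & A = [set y | (q < y)%O] \/
                                           A = [set y | (y < q)%O]) /\
      forall x, A (Order.max (lo a) (Order.min x (hi a))) <-> A x]).
Proof.
move=> nomax lohi mono lostrict histrict cK exK Qmono Qsmall lim.
set r := fun a x => _; set S := fun a => _.
have rlo a x : (x <= lo a)%O -> r a x = lo a.
  by move=> xl; rewrite /r min_l ?max_l // (le_trans xl).
have rhi a x : (hi a <= x)%O -> r a x = hi a.
  by move=> xl; rewrite /r min_r ?max_r // (le_trans xl).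
have rmid a x : (lo a <= x <= hi a)%O -> r a x = x.
  by move=> /andP[lx xh]; rewrite /r min_l ?max_r.
have rP a x : r a x = x <-> (lo a <= x <= hi a)%O.
  split=> [<-|]; last exact: rmid.
  by rewrite /r le_max lexx /= ge_max lohi ge_min lexx orbT.
have rin a x : (lo a <= r a x <= hi a)%O.
  by rewrite /r le_max lexx /= ge_max lohi ge_min lexx orbT.
have KE a : [set x | r a x = x] = [set x | (lo a <= x <= hi a)%O].
  by apply/seteqP; split => x /rP.
have Kmono a b x : (a <= b)%O -> r a x = x -> r b x = x.
  move=> ab /rP/andP[lx xh]; apply: rmid; have /andP[l h] := mono _ _ ab.
  by rewrite (le_trans l lx) (le_trans xh h).
have rr a b x : (a <= b)%O -> r a (r b x) = r a x.
  move=> ab; have /andP[l h] := mono _ _ ab.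
  have [xl|lx] := leP x (lo b); first by rewrite (rlo b x)// !(rlo a)// (le_trans xl).
  have [xh|hx] := leP x (hi b); first by rewrite (rmid b) // (ltW lx).
  by rewrite (rhi b x) ?ltW// !(rhi a)// (le_trans h) ?ltW.
have Smono a b : (a <= b)%O -> S a `<=` S b.
  move=> ab A [[q Qq AE] sat]; split; first by exists q => //; exact: Qmono ab _ Qq.
  by move=> x; rewrite -(sat (r b x)) -/(r a _) (rr _ _ _ ab) sat.
split => //.
- move=> a; apply: max_fun_continuous; first by move=> ?; exact: cvg_cst.
  by apply: min_fun_continuous => ?; [exact: cvg_id|exact: cvg_cst].
- by move=> a b x ab; apply: (Kmono a) => //; apply: rmid; exact: rin.
- by move=> a; rewrite KE.
- move=> C cC.
  have [|||B [b Bb] CB] := @compact_directed_cover _ C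
      [set B | exists b, B `<=` [set x | r b x = x]] cC; last 1 first.
  + by exists b; exact: subset_trans Bb.
  + by exists i0.
  + move=> B B' [b Bb] [b' Bb']; exists (Order.max b b').
    by move=> x [/Bb|/Bb'] /Kmono; apply; rewrite le_max lexx ?orbT.
  + move=> x _; have [a /andP[lx xh]] := exK x; have [b ab] := nomax a.
    exists [set x | r b x = x]; first by exists b.
    have /andP[l h] := mono _ _ (ltW ab).
    rewrite KE; have -> : [set y | (lo b <= y <= hi b)%O] =
      [set y | (lo b <= y)%O] `&` [set y | (y <= hi b)%O].
      by apply/seteqP; split => y /=; [case/andP|case=> -> ->].
    apply: filterI.
      have [lbx|] := ltP (lo b) x.
        apply: (@filterS _ _ _ [set y | (lo b < y)%O]); first by move=> y; exact: ltW.
        by apply: open_nbhs_nbhs; split; [exact: open_gt|].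
      (* Here [x] is at most [lo b], so nothing lies below [lo b]: a smaller point would force
         [lo b < lo a], against [lo a <= x]. *)
      move=> xlb; apply: nearW => y /=; rewrite leNgt; apply/negP => ylb.
      have := lostrict _ _ _ ab (lt_le_trans ylb l).
      by rewrite ltNge (le_trans lx xlb).
    have [lbx|] := ltP x (hi b).
      apply: (@filterS _ _ _ [set y | (y < hi b)%O]); first by move=> y; exact: ltW.
      by apply: open_nbhs_nbhs; split; [exact: open_lt|].
    move=> xlb; apply: nearW => y /=; rewrite leNgt; apply/negP => ylb.
    have := histrict _ _ _ ab (le_lt_trans h ylb).
    by rewrite ltNge (le_trans xlb xh).
- move=> a b x ab /rP; have /andP[l h] := mono _ _ (ltW ab); move=> rx.
  apply: (rmid); rewrite !leNgt; apply/andP; split; apply/negP => lt.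
    have ll := lostrict _ _ _ ab lt; move: rx.
    have [xl|lx] := leP x (lo b); first by rewrite rlo // leNgt ll.
    rewrite rmid; last by rewrite (ltW lx) (le_trans (ltW lt)) ?(le_trans (lohi a)).
    by rewrite leNgt lt.
  have ll := histrict _ _ _ ab lt; move: rx.
  have [xl|lx] := leP (hi b) x; first by rewrite rhi // andbC leNgt ll.
  rewrite rmid; last by rewrite (ltW lx) andbT (le_trans l) // (le_trans (lohi a)) ?ltW.
  by rewrite andbC leNgt lt.
- by move=> a A [[q _ [->|->]] _]; [exact: open_gt|exact: open_lt].
- by move=> a A x [_ sat]; exact: sat.
- move=> a; apply: (@small_sub _ _ _ _
    (((fun q => [set y | (q < y)%O]) @` Q a) `|` ((fun q => [set y | (y < q)%O]) @` Q a))).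
    by move=> A [[q Qq [->|->]] _]; [left|right]; exists q.
  by apply: small_setU; exact: small_image.
- move=> c e ce x O /rP/andP[lx xh]; set K := [set y | _].
  have FF := limit_base_filter K x Smono ce.
  suff : limit_base S c K x --> x by exact.
  apply: order_cvg => [u ux|v xv].
    have [ul|lu] := ltP u (lo e).
      exists 0%N, setT; split => //; first exact: latT.
      by move=> y [_ /rP/andP[ly _]]; exact: lt_le_trans ly.
    have [[n [q [Qq /andP[lq qh] /andP[uq qx]]]] _] := lim _ _ ce _ _ ux lu xh.
    (* As [lo (c n) <= q < hi (c n)], clamping at stage [c n] moves no point across [q], so this ray
       is saturated. *)
    exists n, [set y | (q < y)%O]; split => //; last by move=> y [/= + _]; exact: le_lt_trans.
    apply: lat_base; split; first by exists q => //; left.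
    by move=> y /=; rewrite lt_max lt_min qh andbT ltNge lq.
  have [ul|lu] := ltP (hi e) v.
    exists 0%N, setT; split => //; first exact: latT.
    by move=> y [_ /rP/andP[_ yh]]; exact: le_lt_trans ul.
  have [_ [n [q [Qq /andP[lq qh] /andP[uq qx]]]]] := lim _ _ ce _ _ xv lx lu.
  exists n, [set y | (y < q)%O]; split => //.
    apply: lat_base; split; first by exists q => //; right.
    by move=> y /=; rewrite gt_max gt_min lq /= [(hi _ < _)%O]ltNge qh orbF.
  by move=> y [/= yq _]; exact: lt_le_trans qx.
Qed.

(** * Ordinals *)

Lemma well_order_bot {d} {T : orderType d} (x : T) :
  well_order T -> exists b : T, forall y, (b <= y)%O.
Proof.
move=> wo; have [|b [_ bP]] := wo setT; first by exists x.
by exists b => y; exact: bP.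
Qed.

Lemma well_order_interval_compact {d} {T : orderTopologicalType d} (a b : T) :
  well_order T -> compact [set x | (a <= x <= b)%O].
Proof.
move=> wo; apply: order_interval_compact => A /wo[c [Ac cP]] _.
by exists c; split => // z; apply.
Qed.

Lemma small_inj {d} {I : orderType d} (i0 : I) T U (f : T -> U) (B : set T) A :
  {in B &, injective f} -> f @` B `<=` A -> small I A -> small I B.
Proof.
move=> finj fBA sA g.
have /choice[v vP] u : exists i, forall t, B t -> f t = u -> i = g t.
  have [[t [Bt <-]]|nt] := pselect (exists t, B t /\ f t = u).
    by exists (g t) => t' Bt' /finj ->; rewrite ?inE.
  by exists i0 => t Bt tu; case: nt; exists t.
have [b bP] := sA v; exists b => t Bt.
by rewrite -(vP (f t) t) // bP //; apply: fBA; exists t.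
Qed.

Lemma countable_small {d} {I : orderType d} (i0 : I) T (A : set T) :
  small I [set: nat] -> countable A -> small I A.
Proof.
move=> sN /countable_injP[f finj].
by apply: (small_inj i0 finj _ sN).
Qed.

Section cardinal.
Context {d} {K : orderType d}.
Hypothesis Kreg : uncountable_regular_cardinal K.

(** An unbounded map on [A] has cofinal image, and by regularity a cofinal set has at least the
    cardinality of [K]. *)
Lemma regular_small T (A : set T) : ~ ([set: K] #<= A)%card -> small K A.
Proof.
have [_ _ _ cof] := Kreg; move=> nA f; apply: contrapT => nb; apply: nA.
apply: card_le_trans (card_image_le f A); apply: cof => b.
apply: contrapT => nx; apply: nb; exists b => x Ax.
rewrite leNgt; apply/negP => bx; apply: nx; exists (f x); last exact: ltW.
by exists x.
Qed.

Lemma regular_long_index : long_index K.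
Proof.
have [wo unc _ cof] := Kreg; split => //.
  by apply: regular_small => /sub_countable cK; exact/unc/cK.
move=> a; apply: contrapT => na; apply: unc.
apply: (sub_countable (B := [set a])); last exact: finite_set_countable.
apply: cof => x; exists a => //.
by rewrite leNgt; apply/negP => ax; apply: na; exists x.
Qed.

Lemma regular_initial_small a : small K [set x : K | (x <= a)%O].
Proof.
have [_ _ ini _] := Kreg.
apply: (@small_sub _ _ _ _ ([set x | (x < a)%O] `|` [set a])).
  by move=> x /=; rewrite le_eqVlt => /orP[/eqP|]; [right|left].
apply: small_setU; last exact: small_set1.
exact: regular_small (ini a).
Qed.

End cardinal.

Lemma clamped_cardinal {d} {K : orderTopologicalType d} :
  uncountable_regular_cardinal K ->
  exists (r : K -> K -> K) S, clamped r S.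
Proof.
move=> Kreg; have [wo unc _ _] := Kreg; have [_ _ nomax] := regular_long_index Kreg.
have [k0] : [set: K] !=set0.
  by apply/set0P/eqP => K0; apply: unc; rewrite K0; exact: countable0.
move=> _; have [bot botP] := well_order_bot k0 wo.
do 2!eexists; apply: (@clamped_order _ _ k0 _ K (fun=> bot) id
  (fun a => [set q | (q <= a)%O])) => //.
- by move=> a b ab; rewrite lexx.
- by move=> a b x _; rewrite ltNge botP.
- by move=> a; exact: well_order_interval_compact.
- by move=> x; exists x; rewrite botP lexx.
- by move=> a b ab x /= xa; exact: le_trans xa ab.
- exact: regular_initial_small.
- move=> c e [cS ce cP] x y xy _ ye; split.
    have [n xn] := cP x (lt_le_trans xy ye).
    by exists n, x; rewrite /= botP lexx xn xy (ltW xn).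
  have [n xn] := cP x (lt_le_trans xy ye).
  (* The minimum keeps the endpoint within stage [c n] even when [y] is the limit [e] itself. *)
  exists n, (Order.min y (c n)).
  rewrite /= !ge_min !lexx orbT andbT !lt_min xy xn; split => //.
  by rewrite !(le_lt_trans (botP x)).
Qed.

(** A successor ordinal is compact, so every stage can be the whole space with all points as
    endpoints. They are few because [L] embeds into a proper initial segment of [K]. *)
Lemma clamped_successor {d} {K : orderType d} {dL} {L : orderTopologicalType dL} :
  uncountable_regular_cardinal K -> successor_ordinal L -> ordinal_lt L K ->
  exists (r : K -> L -> L) S, clamped r S.
Proof.
move=> Kreg [wo [m mP]] [a [f [fL finj _]]].
have [bot botP] := well_order_bot m wo.
do 2!eexists; apply: (@clamped_order _ K a _ L (fun=> bot) (fun=> m)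
  (fun=> setT)) => //.
- by have [] := regular_long_index Kreg.
- by move=> _ _ _; rewrite !lexx.
- by move=> _ _ x _; rewrite ltNge botP.
- by move=> _ _ x _; rewrite ltNge mP.
- by move=> _; exact: well_order_interval_compact.
- by move=> x; exists a; rewrite botP mP.
- move=> _; apply: (small_inj a finj _ (regular_initial_small Kreg a)).
  by rewrite fL => x /ltW.
- move=> c e _ x y xy _ _; split; exists 0%N.
    by exists x; rewrite botP (lt_le_trans xy (mP y)) lexx xy.
  by exists y; rewrite mP (le_lt_trans (botP x) xy) lexx xy.
Qed.

Lemma CSHP_ordinal_product (dK : Order.disp_t) (K : orderTopologicalType dK) (n j : nat)
    (dl : 'I_j -> Order.disp_t) (lam : forall i : 'I_j, orderTopologicalType (dl i)) :
  uncountable_regular_cardinal K ->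
  (forall i : 'I_j, successor_ordinal (lam i) /\ ordinal_lt (lam i) K) ->
  CSHP (prod_topology (fun _ : 'I_n => (K : topologicalType)) *
        prod_topology (fun i : 'I_j => (lam i : topologicalType)))%type.
Proof.
move=> Kreg lamP; have lK := regular_long_index Kreg.
have [wo unc _ _] := Kreg; have [_ sN _] := lK.
have [k0 _] : [set: K] !=set0.
  by apply/set0P/eqP => K0; apply: unc; rewrite K0; exact: countable0.
have [r [S cK]] := clamped_cardinal Kreg.
pose C i := cid (clamped_successor Kreg (lamP i).1 (lamP i).2).
pose C' i := cid (svalP (C i)).
apply: (@CSHP_of_clamped _ K _ _ _ _ lK (clamped_pair
  (clamped_prod k0 sN (fun _ : 'I_n => cK)) (clamped_prod k0 sN (fun i => svalP (C' i))))).
by apply: hausdorff_pair; apply: hausdorff_product => i; exact: order_hausdorff.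
Qed.

(** * The long ray and the long line *)

(** An unbounded sequence would write [W] as a countable union of countable initial segments; a
    greatest element would make [W] countable as well. *)
Lemma omega1_long_index {d} {W : orderType d} : is_omega1 W -> long_index W.
Proof.
move=> [wo unc ini]; split => //.
  move=> f; apply: contrapT => nb; apply: unc.
  apply: (@sub_countable _ _ _ (\bigcup_(n in [set: nat]) [set x | (x < f n)%O])).
    apply: subset_card_le => x _; apply: contrapT => nx; apply: nb; exists x => n _.
    by rewrite leNgt; apply/negP => xn; apply: nx; exists n.
  by apply: bigcup_countable.
move=> a; apply: contrapT => na; apply: unc.
apply: (@sub_countable _ _ _ (\bigcup_(b in [set: bool])
    (if b then [set x | (x < a)%O] else [set a]))).
  apply: subset_card_le => x _.
  have [ax|xa] := leP a x; last by exists true.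
  exists false => //; apply/eqP; rewrite eq_le ax andbT leNgt.
  by apply/negP => lax; apply: na; exists x.
by apply: bigcup_countable => // -[_|_]; [exact: ini|exact: finite_set_countable].
Qed.

Lemma omega1_initial_small {d} {W : orderType d} (a : W) :
  is_omega1 W -> small W [set x | (x <= a)%O].
Proof.
move=> W1; have [_ sN _] := omega1_long_index W1; have [_ _ ini] := W1.
apply: (@small_sub _ _ _ _ ([set x | (x < a)%O] `|` [set a])).
  by move=> x /=; rewrite le_eqVlt => /orP[/eqP|]; [right|left].
apply: small_setU; last exact: small_set1.
exact: countable_small (ini a).
Qed.

Local Notation R := Rdefinitions.R.

(* [lt] may be the order of [X] or its converse, so that both halves of the
   long line are covered. *)
Section half_line.
Context {d} {W : orderType d} {X : Type} (lt : X -> X -> Prop) (A : set X)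
  (f : X -> W * R).
Hypotheses (W1 : is_omega1 W)
  (fiso : ord_iso_on lt lex_lt A (long_ray_set W) f).

Lemma ray_surj (w : W) (t : R) : (0 <= t)%R -> (t < 1)%R ->
  exists2 x, A x & f x = (w, t).
Proof.
move=> t0 t1; have [fA _ _] := fiso.
have : long_ray_set W (w, t) by split; [exact/RleP|exact/RltP].
by rewrite -fA => -[x Ax fx]; exists x.
Qed.

Lemma ray_range x : A x -> (0 <= (f x).2)%R /\ (((f x).2 : R) < 1)%R.
Proof.
move=> Ax; have [fA _ _] := fiso.
have [/RleP ? /RltP ?] : long_ray_set W (f x) by rewrite -fA; exists x.
by [].
Qed.

Lemma ray_ltP x y : A x -> A y -> lt x y <->
  ((f x).1 < (f y).1)%O \/ ((f x).1 = (f y).1 /\ ((f x).2 < (f y).2)%R).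
Proof.
move=> Ax Ay; have [_ _ /(_ x y Ax Ay) ->] := fiso.
by split=> -[?|[? /RltP ?]]; [left|right|left|right].
Qed.

Lemma ray_dense x y : A x -> A y -> lt x y ->
  exists2 q, A q /\ (lt x q /\ lt q y) &
    (f q).1 = (f x).1 /\ exists t : rat, (f q).2 = ratr t.
Proof.
move=> Ax Ay /(ray_ltP Ax Ay) xy.
have [[x0 x1] [y0 y1]] := (ray_range Ax, ray_range Ay).
(* The rational is sought in the fibre of [x], below [y] if [y] lies in that fibre and below its
   open end [1] otherwise. *)
pose u := if (f x).1 == (f y).1 then (f y).2 else 1%R.
have xu : ((f x).2 < u)%R.
  rewrite /u; case: eqP => // fxy; case: xy => [|[]//].
  by rewrite fxy ltxx.
have u1 : (u <= 1)%R by rewrite /u; case: eqP => // _; exact: ltW.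
have [t] := rat_in_itvoo xu; rewrite in_itv /= => /andP[xt tu].
have [||q Aq fq] := @ray_surj (f x).1 (ratr t).
- exact: le_trans (ltW xt).
- exact: lt_le_trans tu u1.
exists q; last by rewrite fq; split => //; exists t.
split=> //; split.
  by apply/(ray_ltP Ax Aq); right; rewrite fq.
apply/(ray_ltP Aq Ay); rewrite fq /=; move: tu; rewrite /u.
case: eqP => [-> ?|nxy _]; first by right.
by case: xy => [|[/nxy]]; [left|].
Qed.

(** The infimum has the least first coordinate [w] occurring in [B], and above it the real infimum
    of the fibre of [B] over [w]. The latter is below [1] because that fibre is nonempty. *)
Lemma ray_inf (B : set X) : B !=set0 -> B `<=` A ->
  exists c, [/\ A c, forall x, B x -> ~ lt x c &
    forall z, A z -> (forall x, B x -> ~ lt x z) -> ~ lt c z].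
Proof.
have [wo _ _] := W1; move=> [b Bb] BA.
have [|w [[b0 Bb0 fb0] wP]] := wo ((fst \o f) @` B); first by exists (f b).1; exists b.
rewrite /= in fb0.
pose T := [set t : R | exists2 x, B x & f x = (w, t)].
have Tb : T (f b0).2 by exists b0 => //; rewrite -fb0; case: (f b0).
have T0 : lbound T 0%R.
  by move=> t [x /BA/ray_range[+ _] fx]; rewrite fx.
have T1 : (inf T < 1)%R.
  by apply: le_lt_trans (ge_inf _ Tb) _; [exists 0%R|exact: (ray_range (BA _ Bb0)).2].
have [|//|c Ac fc] := @ray_surj w (inf T).
  by apply: lb_le_inf => //; exists (f b0).2.
exists c; split => // [x Bx|z Az zB].
  move=> /(ray_ltP (BA _ Bx) Ac); rewrite fc /= => -[|[fx]].
    by rewrite ltNge wP //; exists x.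
  rewrite ltNge ge_inf //; first by exists 0%R.
  by exists x => //; rewrite -fx; case: (f x).
move=> /(ray_ltP Ac Az); rewrite fc /= => -[wz|[wz Tz]].
  by apply: (zB b0 Bb0); apply/(ray_ltP (BA _ Bb0) Az); left; rewrite fb0.
have [|t [x Bx fx] tz] := inf_lt _ Tz; first by exists (f b0).2.
by apply: (zB x Bx); apply/(ray_ltP (BA _ Bx) Az); right; rewrite fx.
Qed.

(** The points with second coordinate [0] serve as endpoints of the compact pieces, since comparison
    with them depends on the first coordinate alone. *)
Lemma ray_points : exists p : W -> X,
  forall w, [/\ A (p w), f (p w) = (w, 0%R) &
    forall x, A x -> lt x (p w) <-> ((f x).1 < w)%O].
Proof.
have /choice[p pP] w : exists x, A x /\ f x = (w, 0%R).
  by have [||x ? ?] := @ray_surj w 0%R; rewrite ?lexx ?ltr01 //; exists x.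
exists p => w; have [Ap fp] := pP w; split => // x Ax.
rewrite (ray_ltP Ax Ap) fp /=; split => [[//|[_ lt0]]|]; last by left.
by have := lt_le_trans lt0 (ray_range Ax).1; rewrite ltxx.
Qed.

Lemma ray_rational_small w : small W
  [set q | A q /\ ((f q).1 <= w)%O /\ exists t : rat, (f q).2 = ratr t].
Proof.
have [_ finj _] := fiso; have [_ sN _] := omega1_long_index W1.
apply: (@small_inj _ _ w _ _ f _ ([set x | (x <= w)%O] `*` range (@ratr R))).
- by move=> x y; rewrite !inE => -[Ax _] [Ay _]; apply: finj; rewrite inE.
- by move=> _ [q [_ [qw [t qt]]] <-]; split => //; exists t.
- apply: small_setX => //; first exact: omega1_initial_small.
  apply: small_image; exact: countable_small.
Qed.

End half_line.

Lemma CSHP_long_ray (dW : Order.disp_t) (W : orderType dW) (d : Order.disp_t)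
    (X : orderTopologicalType d) :
  is_omega1 W -> is_long_ray_order W X -> CSHP X.
Proof.
move=> W1 [f fiso]; have lW := omega1_long_index W1; have [wo _ nomax] := lW.
have [w _] : [set: W] !=set0.
  by have [_ unc _] := W1; apply/set0P/eqP => K0; apply: unc; rewrite K0; exact: countable0.
have [w0 w0P] := well_order_bot w wo.
have [p pP] := ray_points fiso.
have pltP v x : (x < p v)%O <-> ((f x).1 < v)%O by have [_ _] := pP v; apply.
have fp v : f (p v) = (v, 0%R) by have [] := pP v.
have pbot x : (p w0 <= x)%O.
  by rewrite leNgt; apply/negP => /pltP; rewrite ltNge w0P.
have pmono v v' : (v < v')%O -> (p v < p v')%O by move=> vv; apply/pltP; rewrite fp.
have := clamped_order w (lo := fun=> p w0) (hi := p)
  (Q := fun v => [set q | setT q /\ ((f q).1 <= v)%O /\ exists t : rat, (f q).2 = ratr t]).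
move=> cl; apply: CSHP_of_clamped lW (cl nomax _ _ _ _ _ _ _ _ _) => {cl}.
- exact: order_hausdorff.
- by move=> v; exact: pbot.
- move=> u v; rewrite lexx le_eqVlt => /predU1P[->|/pmono/ltW//].
  by rewrite lexx.
- by move=> u v x _; rewrite ltNge pbot.
- by move=> u v x uv _; exact: pmono.
- move=> v; apply: order_interval_compact => B B0 _.
  have [c [_ cB cP]] := ray_inf W1 fiso B0 (@subsetT _ B).
  exists c; split=> [x /cB/negP|z zB]; first by rewrite leNgt.
  rewrite leNgt; apply/negP; apply: cP => // x /zB; rewrite leNgt => /negP; exact.
- move=> x; have [v xv] := nomax (f x).1.
  by exists v; rewrite pbot ltW //; apply/pltP.
- by move=> u v uv q [_ [qu qt]]; split => //; split => //; exact: le_trans uv.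
- exact: ray_rational_small W1 fiso.
- move=> c e [cS ce cP] x y xy _ ye.
  have [//|//|q [_ [xq qy]] [fq qt]] := ray_dense fiso (x := x) (y := y) _ _ xy.
  (* From [q < y <= p e] the first coordinate of [q] is below [e], hence below some [c n]; the same
     rational point serves both halves of the limit condition. *)
  have [n qn] : exists n, ((f q).1 < c n)%O by apply/cP/pltP; exact: lt_le_trans ye.
  split; exists n, q; rewrite ?xq ?qy ?(ltW xq) ?(ltW qy).
    by rewrite pbot; split => //; [split => //; split => //; exact: ltW|apply/pltP].
  rewrite (le_lt_trans (pbot x) xq); split => //.
    by split => //; split => //; exact: ltW.
  by apply/ltW/pltP.
Qed.

Lemma CSHP_long_line (dW : Order.disp_t) (W : orderType dW) (d : Order.disp_t)
    (X : orderTopologicalType d) :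
  is_omega1 W -> is_long_line_order W X -> CSHP X.
Proof.
move=> W1 [o [f [g [fiso giso]]]].
have lW := omega1_long_index W1; have [wo _ nomax] := lW.
have [w _] : [set: W] !=set0.
  by have [_ unc _] := W1; apply/set0P/eqP => K0; apply: unc; rewrite K0; exact: countable0.
have [p pP] := ray_points fiso; have [m mP] := ray_points giso.
have op v : (o <= p v)%O by have [] := pP v.
have mo v : (m v <= o)%O by have [] := mP v.
have mp v : (m v <= p v)%O := le_trans (mo v) (op v).
have fp v : f (p v) = (v, 0%R) by have [] := pP v.
have gm v : g (m v) = (v, 0%R) by have [] := mP v.
have pltP v x : (o <= x)%O -> (x < p v)%O <-> ((f x).1 < v)%O.
  by have [_ _] := pP v; apply.
have mltP v x : (x <= o)%O -> (m v < x)%O <-> ((g x).1 < v)%O.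
  by have [_ _] := mP v; apply.
have pmono v v' : (v < v')%O -> (p v < p v')%O by move=> vv; apply/pltP; rewrite ?fp.
have mmono v v' : (v < v')%O -> (m v' < m v)%O by move=> vv; apply/mltP; rewrite ?gm.
have := clamped_order w (lo := m) (hi := p) (Q := fun v =>
  [set q | (o <= q)%O /\ ((f q).1 <= v)%O /\ exists t : rat, (f q).2 = ratr t] `|`
  [set q | (q <= o)%O /\ ((g q).1 <= v)%O /\ exists t : rat, (g q).2 = ratr t]).
move=> cl; apply: CSHP_of_clamped lW (cl nomax mp _ _ _ _ _ _ _ _) => {cl}.
- exact: order_hausdorff.
- move=> u v; rewrite le_eqVlt => /predU1P[->|uv]; first by rewrite !lexx.
  by rewrite (ltW (pmono _ _ uv)) (ltW (mmono _ _ uv)).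
- by move=> u v x uv _; exact: mmono.
- by move=> u v x uv _; exact: pmono.
- move=> v; apply: order_interval_compact => B [b Bb] Bv.
  have [[b' [Bb' b'o]]|nB] := pselect (exists b, B b /\ (b <= o)%O).
    (* the infimum is the supremum, for [g], of the lower bounds *)
    have [||c [co cU cP]] := ray_inf W1 giso
      (B := [set u | (u <= o)%O /\ forall x, B x -> (u <= x)%O]).
    - by exists (m v); split => // x /Bv/andP[].
    - by move=> u [].
    exists c; split=> [x Bx|z zB].
      have [xo|ox] := leP x o; last exact: le_trans co (ltW ox).
      rewrite leNgt; apply/negP; apply: cP => // u [_ /(_ _ Bx)].
      by rewrite leNgt => /negP.
    rewrite leNgt; apply/negP; apply: cU; split => //.
    exact: le_trans (zB _ Bb') b'o.
  have Bo : B `<=` [set x | (o <= x)%O].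
    by move=> x Bx /=; rewrite leNgt; apply/negP => /ltW xo; apply: nB; exists x.
  have [c [oc cB cP]] := ray_inf W1 fiso (ex_intro _ b Bb) Bo.
  exists c; split=> [x /cB/negP|z zB]; first by rewrite leNgt.
  have [oz|zo] := leP o z; last exact: le_trans (ltW zo) oc.
  rewrite leNgt; apply/negP; apply: cP => // x /zB; rewrite leNgt => /negP; exact.
- move=> x; have [ox|xo] := leP o x.
    have [v xv] := nomax (f x).1.
    by exists v; rewrite (le_trans (mo v) ox) ltW //; apply/pltP.
  have [v xv] := nomax (g x).1.
  by exists v; rewrite (le_trans (ltW xo) (op v)) andbT ltW //; apply/mltP => //; exact: ltW.
- move=> u v uv q [[qo [qu qt]]|[qo [qu qt]]]; [left|right];
    by split => //; split => //; exact: le_trans uv.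
- by move=> v; apply: small_setU;
    [exact: (ray_rational_small W1 fiso)|exact: (ray_rational_small W1 giso)].
- move=> c e [cS ce cP] x y xy mx yp.
  suff [n [q [Qq [mq qp] [xq qy]]]] : exists n q,
      [/\ ((o <= q)%O /\ ((f q).1 <= c n)%O /\ exists t : rat, (f q).2 = ratr t) \/
          ((q <= o)%O /\ ((g q).1 <= c n)%O /\ exists t : rat, (g q).2 = ratr t),
          (m (c n) < q)%O /\ (q < p (c n))%O & (x < q)%O /\ (q < y)%O].
    by split; exists n, q; rewrite ?mq ?qp ?xq ?qy ?ltW.
  (* The rational point is taken on one side of [o]: if [y <= o], density is applied in the reversed
     half with the endpoints exchanged; otherwise [x] is first raised to [Order.max x o]. *)
  have [yo|oy] := leP y o.
    have xo := ltW (lt_le_trans xy yo).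
    have [q [qo [qy xq]] [gq qt]] := ray_dense giso yo xo xy.
    have [n qn] : exists n, ((g q).1 < c n)%O.
      by apply/cP/mltP => //; exact: le_lt_trans xq.
    exists n, q; split => //.
      by right; split => //; split => //; exact: ltW.
    split; first exact/mltP.
    exact: lt_le_trans (lt_le_trans qy yo) (op _).
  have xoy : (Order.max x o < y)%O by rewrite gt_max xy.
  have oxo : (o <= Order.max x o)%O by rewrite le_max lexx orbT.
  have [q [oq [xq qy]] [fq qt]] := ray_dense fiso oxo (ltW oy) xoy.
  have [n qn] : exists n, ((f q).1 < c n)%O.
    by apply/cP/pltP => //; exact: lt_le_trans yp.
  move: xq; rewrite gt_max => /andP[xq oq'].
  exists n, q; split => //.
    by left; split => //; split => //; exact: ltW.
  by split; [exact: le_lt_trans (mo _) oq'|exact/pltP].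
Qed.

Theorem theoremD :
  (* (a) the closed long ray *)
  (forall (dW : Order.disp_t) (W : orderType dW) (d : Order.disp_t)
          (X : orderTopologicalType d),
     is_omega1 W -> is_long_ray_order W X -> CSHP X) /\
  (* (b) the long line *)
  (forall (dW : Order.disp_t) (W : orderType dW) (d : Order.disp_t)
          (X : orderTopologicalType d),
     is_omega1 W -> is_long_line_order W X -> CSHP X) /\
  (* (c) kappa^n x lambda_1 x ... x lambda_j *)
  (forall (dK : Order.disp_t) (K : orderTopologicalType dK) (n j : nat)
          (dl : 'I_j -> Order.disp_t) (lam : forall i : 'I_j, orderTopologicalType (dl i)),
     uncountable_regular_cardinal K ->
     (forall i : 'I_j, successor_ordinal (lam i) /\ ordinal_lt (lam i) K) ->
     CSHP (prod_topology (fun _ : 'I_n => (K : topologicalType)) *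
           prod_topology (fun i : 'I_j => (lam i : topologicalType)))%type).
Proof.
by split; [exact: @CSHP_long_ray|split; [exact: @CSHP_long_line|exact: @CSHP_ordinal_product]].
Qed.
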